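(* Let $N$ be a $k$-entry DFA over alphabet $\Sigma$, and let $G$ be the deterministic labeled graph obtained from $N$ by the construction described in the context. Let $M$ be the minimal DFA of $L(N)$. Interpreting $M$ as a $1$-entry DFA, let $H$ be the deterministic labeled graph obtained from the same construction applied to $M$. Then $H$ is the minimal synchronizing deterministic presentation of $X_G$.
   Context: A $k$-entry DFA $N$ is a set of states $Q_N$ with a total transition function $\delta\colon Q_N\times\Sigma\to Q_N$ (viewed as a labeled graph with edges $q\to\delta(q,a)$ labeled $a$), $k$ entry states $s_1,\dots,s_k$, and accepting set $F$; $L(N)=\bigcup_{i=1}^k\{w\in\Sigma^*:\delta(s_i,w)\in F\}$. A DFA is a $1$-entry DFA; the minimal DFA of a regular language is the DFA with fewest states accepting it. Construction: let $*,\star,\lhd,\rhd$ be distinct symbols not in $\Sigma$; embed $N$, add a vertex $t$ with a self loop labeled $\star$, for each $i=1,\dots,k$ add a vertex $p_i$ with a self loop labeled $*$ and an edge labeled $\lhd$ from $p_i$ to $s_i$, and for each $q\in F$ add an edge labeled $\rhd$ from $q$ to $t$. For a labeled graph $G$, $X_G$ is the set of label sequences of bi-infinite paths. A presentation of a shift $X$ is an essential labeled graph (every vertex has incoming and outgoing edges) $P$ with $X_P=X$; it is deterministic if no vertex has two outgoing edges with the same label; it is synchronizing if for every vertex $r$ there is a word $w$ such that the set of end vertices of all paths labeled $w$ is $\{r\}$. The minimal synchronizing deterministic presentation of $X$ is a synchronizing deterministic presentation of $X$ with the fewest vertices (unique up to isomorphism).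
   Formalization: The formal theorem also assumes that every state of N is reachable from an entry state (otherwise false: an unreachable accepting state with a loop adds sequences to X_G that H lacks), that Σ is nonempty, and that k ≥ 1. *)

(* Defs.v *)
From HB Require Import structures.
From mathcomp Require Import all_boot all_order all_algebra.

Set Implicit Arguments.
Unset Strict Implicit.
Unset Printing Implicit Defensive.

Import GRing.Theory.

Record kdfa (Sigma : finType) (k : nat) : Type := KDFA {
  state : finType;
  delta : state -> Sigma -> state;
  entry : 'I_k -> state;
  accepting : {set state}
}.

Definition run (Sigma : finType) (k : nat) (N : kdfa Sigma k)
    (q : state N) (w : seq Sigma) : state N :=
  foldl (@delta Sigma k N) q w.

Definition lang (Sigma : finType) (k : nat) (N : kdfa Sigma k) :
    {pred seq Sigma} :=
  [pred w | [exists i : 'I_k, run (entry N i) w \in accepting N]].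

Definition reachable_states (Sigma : finType) (k : nat) (N : kdfa Sigma k) :
    Prop :=
  forall q : state N, exists (i : 'I_k) (w : seq Sigma), run (entry N i) w = q.

Definition minimal_dfa (Sigma : finType) (M : kdfa Sigma 1)
    (L : {pred seq Sigma}) : Prop :=
  lang M =i L /\
  forall M' : kdfa Sigma 1, lang M' =i L -> #|state M| <= #|state M'|.

(* Finite graphs whose edges form a set of triples (source, label, target).   *)
Record lgraph (A : Type) : Type := LGraph {
  vertex : finType;
  edge : vertex -> A -> vertex -> bool
}.

Definition shift_of (A : Type) (G : lgraph A) (x : int -> A) : Prop :=
  exists p : int -> vertex G, forall i : int, edge (p i) (x i) (p (i + 1)%R).

Definition essential (A : Type) (G : lgraph A) : Prop :=
  forall v : vertex G,
    (exists (u : vertex G) (a : A), edge u a v) /\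
    (exists (a : A) (w : vertex G), edge v a w).

Definition presentation (A : Type) (P : lgraph A) (X : (int -> A) -> Prop) :
    Prop :=
  essential P /\ forall x : int -> A, shift_of P x <-> X x.

Definition deterministic (A : Type) (G : lgraph A) : Prop :=
  forall (u : vertex G) (a : A) (v v' : vertex G),
    edge u a v -> edge u a v' -> v = v'.

Fixpoint walk (A : Type) (G : lgraph A) (u : vertex G) (w : seq A)
    (v : vertex G) : bool :=
  if w is a :: w' then [exists u', edge u a u' && walk u' w' v] else u == v.

Definition end_vertices (A : Type) (G : lgraph A) (w : seq A) :
    {set vertex G} :=
  [set v | [exists u, walk u w v]].

Definition synchronizing (A : Type) (G : lgraph A) : Prop :=
  forall r : vertex G, exists w : seq A, end_vertices G w = [set r].

Definition sync_det_presentation (A : Type) (P : lgraph A)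
    (X : (int -> A) -> Prop) : Prop :=
  [/\ presentation P X, deterministic P & synchronizing P].

Definition isomorphic (A : Type) (G H : lgraph A) : Prop :=
  exists2 f : vertex G -> vertex H, bijective f &
    forall (u : vertex G) (a : A) (v : vertex G),
      edge u a v = edge (f u) a (f v).

(* The last clause, uniqueness up to isomorphism, is what justifies speaking
   of "the" minimal synchronizing deterministic presentation. *)
Definition minimal_sync_det_presentation (A : Type) (P : lgraph A)
    (X : (int -> A) -> Prop) : Prop :=
  [/\ sync_det_presentation P X,
      forall P' : lgraph A, sync_det_presentation P' X ->
        #|vertex P| <= #|vertex P'|
    & forall P' : lgraph A, sync_det_presentation P' X ->
        #|vertex P'| = #|vertex P| -> isomorphic P P'].

(* The fresh symbols: the asterisk (loops at the p_i), the star (loop at t),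
   and the left and right triangles. *)
Variant marker : Type := Ast | Star | Lhd | Rhd.

Definition ext_alphabet (Sigma : finType) : Type := (Sigma + marker)%type.

(* inl q is the state q, inr (inl i) is p_i, and inr (inr tt) is t.           *)
Definition shift_vertex (Sigma : finType) (k : nat) (N : kdfa Sigma k) :
    finType :=
  (state N + ('I_k + unit))%type.

Definition shift_edge (Sigma : finType) (k : nat) (N : kdfa Sigma k)
    (u : shift_vertex N) (a : ext_alphabet Sigma) (v : shift_vertex N) : bool :=
  match u, a, v with
  | inl q, inl c, inl q' => delta q c == q'
  | inr (inr _), inr Star, inr (inr _) => true
  | inr (inl i), inr Ast, inr (inl j) => i == j
  | inr (inl i), inr Lhd, inl q => q == entry N i
  | inl q, inr Rhd, inr (inr _) => q \in accepting N
  | _, _, _ => false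
  end.

Definition shift_graph (Sigma : finType) (k : nat) (N : kdfa Sigma k) :
    lgraph (ext_alphabet Sigma) :=
  LGraph (@shift_edge Sigma k N).

(* Main.v *)
(* By compactness, the shift of a finite graph is determined by the labels of
   its finite walks, and for the graph built from a trim automaton these depend
   only on its language; hence G and H present the same shift. Every state of M
   is reachable, so H is synchronizing, and any two vertices of H have different
   follower sets. In a synchronizing deterministic presentation the follower set
   of a vertex is the set of continuations of a synchronizing word; prefixing a
   word synchronizing P' to a word synchronizing H to u matches u with a vertex
   of P' having the same follower set, which embeds H into every such P'. *)
Require Import Defs.
From HB Require Import structures.
From mathcomp Require Import all_boot all_order all_algebra.
From mathcomp Require Import boolp.
From mathcomp Require Import zify.

Set Implicit Arguments.
Unset Strict Implicit.
Unset Printing Implicit Defensive.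

Import GRing.Theory.

(** * Walks, follower sets and factors of a labeled graph *)

Section Walks.

Variables (A : Type) (G : lgraph A).
Implicit Types (u v r : vertex G) (a : A) (w : seq A).

Definition follower u w : bool := [exists v, walk u w v].

Definition factor w : bool := [exists u, follower u w].

Lemma walk_cat u w1 w2 v :
  walk u (w1 ++ w2) v = [exists r, walk u w1 r && walk r w2 v].
Proof.
elim: w1 u => [|a w1 IHw] u /=.
  apply/idP/existsP => [uv|[r /andP[/eqP->]]//].
  by exists u; rewrite eqxx.
apply/existsP/existsP => [[u' /andP[uu']]|[r /andP[/existsP[u' /andP[uu' u'r]] rv]]].
  rewrite IHw => /existsP[r /andP[u'r rv]]; exists r; rewrite rv andbT.
  by apply/existsP; exists u'; rewrite uu'.
by exists u'; rewrite uu' IHw; apply/existsP; exists r; rewrite u'r.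
Qed.

Lemma walk1 u a v : walk u [:: a] v = edge u a v.
Proof.
apply/existsP/idP => [[r /andP[ur /eqP<-]]//|uv].
by exists v; rewrite uv /=.
Qed.

Lemma follower_nil u : follower u [::].
Proof. by apply/existsP; exists u => /=. Qed.

Lemma follower_cons u a w :
  follower u (a :: w) = [exists v, edge u a v && follower v w].
Proof.
apply/existsP/existsP => [[v /existsP[r /andP[ur rv]]]|[r /andP[ur /existsP[v rv]]]].
  by exists r; rewrite ur; apply/existsP; exists v.
by exists v; apply/existsP; exists r; rewrite ur.
Qed.

Lemma follower1 u a : follower u [:: a] -> exists v, edge u a v.
Proof. by rewrite follower_cons => /existsP[v /andP[uv _]]; exists v. Qed.

Lemma follower_cat u w1 w2 :
  follower u (w1 ++ w2) = [exists v, walk u w1 v && follower v w2].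
Proof.
apply/existsP/existsP => [[v]|[r /andP[ur /existsP[v rv]]]].
  rewrite walk_cat => /existsP[r /andP[ur rv]].
  by exists r; rewrite ur; apply/existsP; exists v.
by exists v; rewrite walk_cat; apply/existsP; exists r; rewrite ur.
Qed.

Lemma follower_catl u w1 w2 : follower u (w1 ++ w2) -> follower u w1.
Proof.
by rewrite follower_cat => /existsP[v /andP[uv _]]; apply/existsP; exists v.
Qed.

Lemma factor_catr w1 w2 : factor (w1 ++ w2) -> factor w2.
Proof.
case/existsP=> u; rewrite follower_cat => /existsP[v /andP[_ vw]].
by apply/existsP; exists v.
Qed.

Lemma end_vertices_cat w1 w2 v :
  (v \in end_vertices G (w1 ++ w2)) =
  [exists r in end_vertices G w1, walk r w2 v].
Proof.
rewrite inE; apply/existsP/existsP => [[u]|[r /andP[]]].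
  rewrite walk_cat => /existsP[r /andP[ur rv]].
  by exists r; rewrite inE rv andbT; apply/existsP; exists u.
rewrite inE => /existsP[u ur] rv; exists u.
by rewrite walk_cat; apply/existsP; exists r; rewrite ur.
Qed.

Lemma follower_sync w1 w2 r :
  end_vertices G w1 = [set r] -> follower r w2 = factor (w1 ++ w2).
Proof.
move=> w1r; apply/idP/existsP => [rw2|[u]].
  have: r \in end_vertices G w1 by rewrite w1r set11.
  rewrite inE => /existsP[u ur]; exists u.
  by rewrite follower_cat; apply/existsP; exists r; rewrite ur.
rewrite follower_cat => /existsP[v /andP[uv vw2]].
suff /set1P<- : v \in [set r] by [].
by rewrite -w1r inE; apply/existsP; exists u.
Qed.

Hypothesis detG : deterministic G.

Lemma deterministic_walk u w v v' : walk u w v -> walk u w v' -> v = v'.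
Proof.
elim: w u => [|a w IHw] u /=; first by move=> /eqP<- /eqP.
move=> /existsP[r /andP[ur rv]] /existsP[r' /andP[ur' rv']].
by move: rv'; rewrite -(detG ur ur'); apply: IHw.
Qed.

(** By determinism [v] is the only [a]-successor of [u], so its follower set is the left quotient by
    [a] of that of [u]. *)
Lemma follower_edge u a v w :
  edge u a v -> follower v w = follower u (a :: w).
Proof.
move=> uv; rewrite follower_cons; apply/idP/existsP => [vw|[v' /andP[uv']]].
  by exists v; rewrite uv.
by rewrite (detG uv uv').
Qed.

End Walks.

(** * Bi-infinite label sequences and their finite windows *)

Section Shifts.

Variables (A : Type) (G : lgraph A).
Implicit Types (x : int -> A) (i : int) (n : nat).
Local Open Scope ring_scope.

Fixpoint word x i n : seq A :=
  if n is n'.+1 then x i :: word x (i + 1) n' else [::].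

Lemma word_cat x i m n :
  word x i (m + n)%N = word x i m ++ word x (i + m%:Z) n.
Proof.
elim: m i => [|m IHm] i /=; first by rewrite addr0.
by rewrite IHm; congr (_ :: _ ++ word _ _ _); lia.
Qed.

Lemma wordSr x i n : word x i n.+1 = word x i n ++ [:: x (i + n%:Z)].
Proof. by rewrite -addn1 word_cat. Qed.

(** [Negz n] is the position [-(n+1)], so its label leads from [pl n.+1] to [pl n]. The two rays are
    glued at position 0. *)
Lemma shift_of_rays (pr pl : nat -> vertex G) x :
    pr 0%N = pl 0%N ->
    (forall n, edge (pr n) (x n%:Z) (pr n.+1)) ->
    (forall n, edge (pl n.+1) (x (Negz n)) (pl n)) ->
  shift_of G x.
Proof.
move=> pr0 rP lP.
exists (fun i => match i with Posz n => pr n | Negz n => pl n.+1 end).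
case=> [n|[|n]].
- by have -> : n%:Z + 1 = n.+1%:Z by lia.
- by rewrite (_ : Negz 0 + 1 = Posz 0) //= pr0.
- by have -> : Negz n.+1 + 1 = Negz n by lia.
Qed.

Lemma walk_ray u w v : essential G -> walk u w v ->
  exists (x : nat -> A) (p : nat -> vertex G), [/\ p 0%N = u,
    forall n, edge (p n) (x n) (p n.+1) & mkseq x (size w) = w].
Proof.
move=> essG.
have /fin_all_exists[nxt nxtP] r :
    exists av : A * vertex G, edge r av.1 av.2.
  by have [_ [a [r' rr']]] := essG r; exists (a, r').
elim: w u => [|a w IHw] u /=.
  move=> _; pose p n := iter n (fun r => (nxt r).2) u.
  by exists (fun n => (nxt (p n)).1), p; split => // n; apply: nxtP.
case/existsP=> u' /andP[uu' /IHw[x [p [p0 pP xw]]]].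
exists (fun n => if n is m.+1 then x m else a).
exists (fun n => if n is m.+1 then p m else u).
split=> // [[|n]|]; [by rewrite p0|exact: pP|].
by rewrite /mkseq /= (iotaDl 1 0) -map_comp -[in RHS]xw.
Qed.

(** A finite walk extends to the right by iterating a chosen successor ([walk_ray]) and to the left
    by iterating a chosen predecessor; both exist because the graph is essential. *)
Lemma essential_factor w : essential G -> factor G w ->
  exists2 x, shift_of G x & word x 0 (size w) = w.
Proof.
move=> essG /existsP[u /existsP[v /(walk_ray essG)[x [p [p0 pP xw]]]]].
have /fin_all_exists[prv prvP] r :
    exists va : vertex G * A, edge va.1 va.2 r.
  by have [[r' [a r'r]] _] := essG r; exists (r', a).
pose q n := iter n (fun r => (prv r).1) u.
pose y i := match i with Posz n => x n | Negz n => (prv (q n)).2 end.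
exists y.
  by apply: (@shift_of_rays p q) => // n; apply: prvP.
have yE n m : word y m%:Z n = map x (iota m n).
  by elim: n m => //= n IHn m; rewrite -IHn; congr (_ :: word _ _ _); lia.
by rewrite (yE _ 0%N).
Qed.

Lemma shift_factor x i n : shift_of G x -> factor G (word x i n).
Proof.
case=> p pP; apply/existsP; exists (p i).
elim: n i => [|n IHn] i; first exact: follower_nil.
by rewrite /= follower_cons; apply/existsP; exists (p (i + 1)); rewrite pP IHn.
Qed.

End Shifts.

(** * Compactness: from finite windows to bi-infinite paths *)

Lemma antitone_pigeonhole (T : finType) (P : nat -> T -> bool) :
    (forall n t, P n.+1 t -> P n t) -> (forall n, exists t, P n t) ->
  exists t, forall n, P n t.
Proof.
move=> antiP exP; apply: contrapT => noP.
(* [N t] is a stage at which [t] fails. By antitonicity every [t] fails at the maximum of these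
   stages, where no witness is left. *)
have /fin_all_exists[N NP] t : exists n, ~~ P n t.
  apply: contrapT => allP; apply: noP; exists t => n.
  by apply/negP => nP; apply: allP; exists n; apply/negP.
have [t Pt] := exP (\max_t N t); case/negP: (NP t).
have : N t <= \max_t N t by apply: leq_bigmax.
move: Pt; elim: (\max_t N t) => [|n IHn] Pt.
  by rewrite leqn0 => /eqP->.
by rewrite leq_eqVlt => /predU1P[->//|]; apply/IHn/antiP.
Qed.

Lemma dependent_choice_ray (T : Type) (Q : nat -> T -> Prop)
    (R : nat -> T -> T -> Prop) (t0 : T) :
    (forall n t, Q n t -> exists2 t', R n t t' & Q n.+1 t') -> Q 0 t0 ->
  exists2 p : nat -> T, p 0 = t0 & forall n, R n (p n) (p n.+1).
Proof.
move=> step Q0.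
have /choice[f fP] (nt : nat * T) :
    exists t', Q nt.1 nt.2 -> R nt.1 nt.2 t' /\ Q nt.1.+1 t'.
  (* [choice] asks for a total relation; [t0] is a default value where [Q] fails. *)
  have [Qt|nQt] := EM (Q nt.1 nt.2); last by exists t0.
  by have [t' ? ?] := step _ _ Qt; exists t'.
pose fix p n := if n is n'.+1 then f (n', p n') else t0.
have Qp n : Q n (p n) by elim: n => //= n /(fP (n, p n))[].
by exists p => // n; have [] := fP (n, p n) (Qp n).
Qed.

Section Compactness.

Variables (A : Type) (G : lgraph A) (x : int -> A).
Local Open Scope ring_scope.

(** The window covers the positions [i - n] to [i - 1], so the walk arrives at [v] at time [i]. *)
Definition has_past (i : int) n (v : vertex G) : bool :=
  [exists u, walk u (word x (i - n%:Z) n) v].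

(* Vertices that a König argument can keep at position i of a path labeled x. *)
Definition viable (i : int) (v : vertex G) : Prop :=
  forall n, has_past i n v && follower v (word x i n).

Lemma has_past0 i v : has_past i 0 v.
Proof. by apply/existsP; exists v => /=. Qed.

Lemma has_pastS i n v :
  has_past i n.+1 v = [exists u, edge u (x (i - 1)) v && has_past (i - 1) n u].
Proof.
have wE : word x (i - n.+1%:Z) n.+1 =
          word x (i - 1 - n%:Z) n ++ [:: x (i - 1)].
  have -> : i - n.+1%:Z = i - 1 - n%:Z by lia.
  by rewrite wordSr; congr (_ ++ [:: x _]); lia.
rewrite /has_past wE.
apply/existsP/existsP => [[u]|[r /andP[rv /existsP[u ur]]]].
  rewrite walk_cat => /existsP[r /andP[ur]]; rewrite walk1 => rv.
  by exists r; rewrite rv; apply/existsP; exists u.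
by exists u; rewrite walk_cat; apply/existsP; exists r; rewrite ur walk1.
Qed.

Lemma has_pastW i n v : has_past i n.+1 v -> has_past i n v.
Proof.
case/existsP=> u /existsP[u' /andP[_ u'v]]; apply/existsP; exists u'.
by have -> : i - n%:Z = i - n.+1%:Z + 1 by lia.
Qed.

Lemma followerW i n (v : vertex G) :
  follower v (word x i n.+1) -> follower v (word x i n).
Proof. by rewrite wordSr => /follower_catl. Qed.

(** For each [n] some successor of [v] reads [n] further letters, but without determinism it may
    vary with [n]; the pigeonhole finds one that serves all [n]. Its past runs through [v]. *)
Lemma viable_next i v : viable i v ->
  exists2 v', edge v (x i) v' & viable (i + 1) v'.
Proof.
move=> vP.
have [||v' v'P] := @antitone_pigeonhole (vertex G)
  (fun n v' => edge v (x i) v' && follower v' (word x (i + 1) n)).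
- by move=> n v' /andP[-> /followerW].
- move=> n; have /andP[_] := vP n.+1.
  by rewrite /= follower_cons => /existsP.
exists v'; first by have /andP[] := v'P 0%N.
case=> [|n]; first by rewrite has_past0 follower_nil.
have /andP[vv' ->] := v'P n.+1; rewrite andbT has_pastS.
apply/existsP; exists v; have -> : i + 1 - 1 = i by lia.
by rewrite vv'; have /andP[] := vP n.
Qed.

Lemma viable_prev i v : viable i v ->
  exists2 u, edge u (x (i - 1)) v & viable (i - 1) u.
Proof.
move=> vP.
have [||u uP] := @antitone_pigeonhole (vertex G)
  (fun n u => edge u (x (i - 1)) v && has_past (i - 1) n u).
- by move=> n u /andP[-> /has_pastW].
- move=> n; have /andP[+ _] := vP n.+1.
  by rewrite has_pastS => /existsP.
exists u; first by have /andP[] := uP 0%N.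
case=> [|n]; first by rewrite has_past0 follower_nil.
have /andP[uv ->] := uP n.+1; rewrite /= follower_cons.
apply/existsP; exists v; have -> : i - 1 + 1 = i by lia.
by rewrite uv; have /andP[] := vP n.
Qed.

(** Windows of length [n + n] centred at 0, cut in the middle, give vertices with [n] letters of
    past and of future; the pigeonhole turns them into one viable vertex. Stepping between viable
    vertices in both directions builds the path. *)
Lemma factor_shift :
  (forall i n, factor G (word x i n)) -> shift_of G x.
Proof.
move=> xP.
have [||v vP] := @antitone_pigeonhole (vertex G)
  (fun n v => has_past 0 n v && follower v (word x 0 n)).
- by move=> n v /andP[/has_pastW-> /followerW].
- move=> n; have /existsP[u] := xP (0 - n%:Z) (n + n)%N.
  rewrite word_cat follower_cat => /existsP[v /andP[uv vw]]; exists v.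
  move: vw; have -> : 0 - n%:Z + n%:Z = 0 :> int by lia.
  by move=> ->; rewrite andbT; apply/existsP; exists u.
have [|//|pr pr0 prP] := @dependent_choice_ray _ (fun n => viable n%:Z)
  (fun n v v' => edge v (x n%:Z) v') v.
  move=> n t /viable_next[t' ? ?]; exists t' => //.
  by have -> : n.+1%:Z = n%:Z + 1 by lia.
have [||pl pl0 plP] := @dependent_choice_ray _ (fun n => viable (- n%:Z))
  (fun n v u => edge u (x (Negz n)) v) v.
- move=> n t /viable_prev[t']; have -> : - n%:Z - 1 = Negz n by lia.
  by move=> ? ?; exists t'.
- by rewrite oppr0.
by apply: (@shift_of_rays _ _ pr pl); rewrite ?pr0.
Qed.

End Compactness.

Lemma eq_factor_shift (A : Type) (G H : lgraph A) :
  factor G =1 factor H -> forall x, shift_of G x <-> shift_of H x.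
Proof.
move=> GH x; split=> xP; apply: factor_shift => i n.
  by rewrite -GH; apply: shift_factor.
by rewrite GH; apply: shift_factor.
Qed.

Lemma presentation_factor (A : Type) (G H : lgraph A) X :
  presentation G X -> presentation H X -> factor G =1 factor H.
Proof.
move=> [essG GX] [essH HX] w; apply/idP/idP => /essential_factor.
  case=> // x /GX/HX xH <-; exact: shift_factor.
case=> // x /HX/GX xH <-; exact: shift_factor.
Qed.

(** * Follower-separated presentations: minimality and uniqueness *)

Definition reduced (A : Type) (G : lgraph A) : Prop :=
  forall u v : vertex G, follower u =1 follower v -> u = v.

Section ReducedPresentation.

Variables (A : Type) (G H : lgraph A) (X : (int -> A) -> Prop).
Hypotheses (GP : sync_det_presentation G X) (HP : sync_det_presentation H X).

(* Read a synchronizing word w of u along some path of H, from v to r, and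
   prefix a word synchronizing H to v: the result synchronizes both graphs. *)
Lemma sync_det_same_follower (u : vertex G) :
  exists r : vertex H, follower u =1 follower r.
Proof.
case: GP HP => Gpres Gdet Gsync [Hpres Hdet Hsync].
have GH := presentation_factor Gpres Hpres.
have [w wu] := Gsync u.
have : factor H w.
  by rewrite -GH -[w]cats0 -(follower_sync _ wu) follower_nil.
case/existsP=> v /existsP[r vr]; exists r.
have [z zv] := Hsync v.
have zwr : end_vertices H (z ++ w) = [set r].
  apply/setP=> r'; rewrite end_vertices_cat zv inE.
  apply/existsP/eqP => [[v' /andP[/set1P-> vr']]|->].
    exact: deterministic_walk vr' vr.
  by exists v; rewrite set11.
have zwu : end_vertices G (z ++ w) = [set u].
  have sub u' : u' \in end_vertices G (z ++ w) -> u' = u.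
    rewrite end_vertices_cat => /existsP[s /andP[_ su']].
    by apply/set1P; rewrite -wu inE; apply/existsP; exists s.
  (* In [G], [z ++ w] can end only at [u], but it might label no walk at all; it does label one
     because it is a factor of [H]. *)
  have : factor G (z ++ w).
    by rewrite GH -[_ ++ w]cats0 -(follower_sync _ zwr) follower_nil.
  case/existsP=> s /existsP[u' su'].
  have u'P : u' \in end_vertices G (z ++ w) by rewrite inE; apply/existsP; exists s.
  apply/setP=> u''; rewrite inE; apply/idP/eqP => [/sub//|->].
  by rewrite -(sub _ u'P).
by move=> w'; rewrite (follower_sync _ zwu) (follower_sync _ zwr) GH.
Qed.

Hypothesis redG : reduced G.

Lemma reduced_embedding :
  exists2 f : vertex G -> vertex H, injective f &
    forall u, follower u =1 follower (f u).
Proof.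
have [f fP] := fin_all_exists sync_det_same_follower.
by exists f => // u v fuv; apply: redG => w; rewrite !fP fuv.
Qed.

Lemma reduced_card : #|vertex G| <= #|vertex H|.
Proof. by have [f /leq_card] := reduced_embedding. Qed.

(** Equal cardinalities make the embedding bijective. It preserves edges because follower sets see
    them: [a] leaves a vertex when [[:: a]] is in its follower set, determinism fixes the follower
    set of the target, and reducedness recovers the target from it. *)
Lemma reduced_isomorphic : #|vertex H| = #|vertex G| -> isomorphic G H.
Proof.
case: GP HP => _ Gdet _ [_ Hdet _] HG.
have [f f_inj fP] := reduced_embedding.
have [g gK fK] : bijective f by apply: inj_card_bij; rewrite ?HG.
exists f; first by exists g.
move=> u a v; apply/idP/idP => uv.
  have [|r ur] := @follower1 _ _ (f u) a.
    by rewrite -fP -(follower_edge Gdet _ uv) follower_nil.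
  rewrite -(fK r) in ur; suff <- : g r = v by [].
  apply: redG => w; rewrite fP (follower_edge Hdet _ ur) -fP.
  by rewrite (follower_edge Gdet _ uv).
have [|v' uv'] := @follower1 _ _ u a.
  by rewrite fP -(follower_edge Hdet _ uv) follower_nil.
suff <- : v' = v by [].
apply: redG => w; rewrite (follower_edge Gdet _ uv') !fP.
by rewrite (follower_edge Hdet _ uv).
Qed.

End ReducedPresentation.

(** * Follower sets and structure of the constructed graph *)

Section ShiftGraph.

Variables (Sigma : finType) (k : nat) (N : kdfa Sigma k).
Local Notation G := (shift_graph N).
Implicit Types (q : state N) (i : 'I_k) (w : seq (ext_alphabet Sigma)).

Lemma shift_graph_follower_letter q c w :
  follower (inl q : vertex G) (inl c :: w) =
  follower (inl (delta q c) : vertex G) w.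
Proof.
rewrite follower_cons; apply/existsP/idP => [[[q'|[|]] //= /andP[/eqP<-]]//|qw].
by exists (inl (delta q c)); rewrite /= eqxx.
Qed.

Lemma shift_graph_follower_letters q z w :
  follower (inl q : vertex G) (map inl z ++ w) =
  follower (inl (run q z) : vertex G) w.
Proof. by elim: z q => //= c z IHz q; rewrite shift_graph_follower_letter. Qed.

Lemma shift_graph_follower_rhd q w :
  follower (inl q : vertex G) (inr Rhd :: w) =
  (q \in accepting N) && follower (inr (inr tt) : vertex G) w.
Proof.
rewrite follower_cons; apply/existsP/idP => [[[|[|[]]] //=]|qw].
by exists (inr (inr tt)).
Qed.

Lemma shift_graph_follower_marker q m w :
  follower (inl q : vertex G) (inr m :: w) -> m = Rhd.
Proof. by rewrite follower_cons => /existsP[v]; case: m. Qed.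

Lemma shift_graph_follower_lhd i w :
  follower (inr (inl i) : vertex G) (inr Lhd :: w) =
  follower (inl (entry N i) : vertex G) w.
Proof.
rewrite follower_cons; apply/existsP/idP => [[[q|[|]] //= /andP[/eqP->]]//|qw].
by exists (inl (entry N i)); rewrite /= eqxx.
Qed.

Lemma shift_graph_follower_ast i w :
  follower (inr (inl i) : vertex G) (inr Ast :: w) =
  follower (inr (inl i) : vertex G) w.
Proof.
rewrite follower_cons.
apply/existsP/idP => [[[q|[j|]] //= /andP[/eqP->]]//|iw].
by exists (inr (inl i)); rewrite /= eqxx.
Qed.

Lemma shift_graph_follower_p i a w :
  follower (inr (inl i) : vertex G) (a :: w) -> a = inr Ast \/ a = inr Lhd.
Proof.
rewrite follower_cons => /existsP[v].
by case: a => [a|[]] //=; [left|right].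
Qed.

(** The right-hand side does not mention [N], which lets the vertices [t] of two constructed graphs
    be compared. *)
Lemma shift_graph_follower_t w :
  follower (inr (inr tt) : vertex G) w =
  all (fun a => if a is inr Star then true else false) w.
Proof.
elim: w => [|a w IHw]; first by rewrite follower_nil.
rewrite follower_cons /= -IHw.
apply/existsP/andP => [[[|[|[]]] /=]|[]].
- by case: a => [|[]].
- by case: a => [|[]].
- by case: a => [|[]].
by case: a => [|[]] // _ tw; exists (inr (inr tt)).
Qed.

Lemma shift_graph_det : deterministic G.
Proof.
case=> [q|[i|[]]] [c|[]] [q'|[i'|[]]] [q''|[i''|[]]] //=.
- by move=> /eqP-> /eqP->.
- by move=> /eqP-> /eqP->.
- by move=> /eqP-> /eqP->.
Qed.

Lemma shift_graph_walk_run q z :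
  walk (inl q : vertex G) (map inl z) (inl (run q z)).
Proof.
elim: z q => [|c z IHz] q; first exact: eqxx.
by apply/existsP; exists (inl (delta q c)); apply/andP; split; [exact: eqxx|exact: IHz].
Qed.

Hypothesis reachN : reachable_states N.

(** A state has an incoming edge by reachability: from some [p_i] if the word reaching it is empty,
    along its last letter otherwise. The letter [c] gives every state an outgoing edge, accepting or
    not. *)
Lemma shift_graph_essential : 0 < #|Sigma| -> essential G.
Proof.
case/card_gt0P=> c _ [q|[i|[]]]; split.
- have [i [z]] := reachN q; case/lastP: z => [<-|z d <-].
    by exists (inr (inl i)), (inr Lhd); rewrite /= eqxx.
  exists (inl (run (entry N i) z)), (inl d) => /=.
  by rewrite /run foldl_rcons.
- by exists (inl c), (inl (delta q c)); rewrite /= eqxx.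
- by exists (inr (inl i)), (inr Ast); rewrite /= eqxx.
- by exists (inr Ast), (inr (inl i)); rewrite /= eqxx.
- by exists (inr (inr tt)), (inr Star).
- by exists (inr Star), (inr (inr tt)).
Qed.

End ShiftGraph.

(** * The factors of the constructed graph depend only on the language *)

Lemma letters_split (Sigma : finType) (w : seq (ext_alphabet Sigma)) :
  exists z w', w = map inl z ++ w' /\
    (w' = [::] \/ exists m w'', w' = inr m :: w'').
Proof.
elim: w => [|[c|m] w [z [w' [-> w'P]]]]; first by exists [::], [::]; auto.
  by exists (c :: z), w'.
exists [::], (inr m :: map inl z ++ w'); split=> //; right.
by exists m, (map inl z ++ w').
Qed.

Section FactorLanguage.

Variables (Sigma : finType) (k k' : nat).
Variables (N : kdfa Sigma k) (N' : kdfa Sigma k').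
Hypotheses (k'_gt0 : 0 < k') (NN' : lang N =i lang N').

(** Cut [w] at its first marker. Without a marker, any entry of [N'] reads it since [delta] is
    total. Otherwise the marker is [Rhd], the letters before it form a word of the common language,
    and only [Star] follows. *)
Lemma entry_follower i w :
  follower (inl (entry N i) : vertex (shift_graph N)) w ->
  exists j, follower (inl (entry N' j) : vertex (shift_graph N')) w.
Proof.
have [z [w' [-> w'P]]] := letters_split w; rewrite shift_graph_follower_letters.
case: w'P => [->|[m [w'' ->]]] zw.
  exists (Ordinal k'_gt0).
  by rewrite shift_graph_follower_letters follower_nil.
move: (zw); rewrite (shift_graph_follower_marker zw) shift_graph_follower_rhd.
case/andP=> zF tw.
have : z \in lang N by apply/existsP; exists i.
rewrite NN' => /existsP[j zj]; exists j.
rewrite shift_graph_follower_letters shift_graph_follower_rhd zj.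
by rewrite shift_graph_follower_t -(shift_graph_follower_t N).
Qed.

(** The index [j] may depend on [w]: only the unions over all entries of [N] and [N'] are
    comparable. The induction strips the loops [Ast] that precede [Lhd]. *)
Lemma initial_follower i w :
  follower (inr (inl i) : vertex (shift_graph N)) w ->
  exists j, follower (inr (inl j) : vertex (shift_graph N')) w.
Proof.
elim: w => [_|a w IHw]; first by exists (Ordinal k'_gt0); rewrite follower_nil.
move=> aw; move: (aw); case: (shift_graph_follower_p aw) => ->.
  rewrite shift_graph_follower_ast => /IHw[j jw]; exists j.
  by rewrite shift_graph_follower_ast.
rewrite shift_graph_follower_lhd => /entry_follower[j jw]; exists j.
by rewrite shift_graph_follower_lhd.
Qed.

Hypothesis reachN : reachable_states N.

Lemma shift_graph_factor w :
  factor (shift_graph N) w -> factor (shift_graph N') w.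
Proof.
case/existsP=> -[q|[i|[]]].
(* A word read from [q] is completed on the left to [Lhd], [z], [w], which starts at [p_i]; the
   prefix is dropped after the transfer to [N']. *)
- have [i [z <-]] := reachN q; rewrite -shift_graph_follower_letters.
  rewrite -shift_graph_follower_lhd => /initial_follower[j jw].
  apply: (@factor_catr _ _ (inr Lhd :: map inl z)).
  by apply/existsP; exists (inr (inl j)).
- case/initial_follower=> j jw.
  by apply/existsP; exists (inr (inl j)).
- rewrite shift_graph_follower_t -(shift_graph_follower_t N') => tw.
  by apply/existsP; exists (inr (inr tt)).
Qed.

End FactorLanguage.

Lemma eq_shift_graph_factor (Sigma : finType) k k'
    (N : kdfa Sigma k) (N' : kdfa Sigma k') :
    0 < k -> 0 < k' -> reachable_states N -> reachable_states N' ->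
  lang N =i lang N' -> factor (shift_graph N) =1 factor (shift_graph N').
Proof.
move=> k_gt0 k'_gt0 NR NR' NN' w.
by apply/idP/idP; apply: shift_graph_factor => // z; rewrite NN'.
Qed.

(** * The minimal DFA: reachability, distinguishability and their effect on its graph *)

Section MinimalDFA.

Variables (Sigma : finType) (M : kdfa Sigma 1) (L : {pred seq Sigma}).
Hypothesis minM : minimal_dfa M L.
Local Notation s := (entry M ord0).

Lemma lang1 (M' : kdfa Sigma 1) w :
  (w \in lang M') = (run (entry M' ord0) w \in accepting M').
Proof. by apply/existsP/idP => [[i]|]; [rewrite ord1|exists ord0]. Qed.

Definition redirect (q1 q2 q : state M) : state M := if q == q2 then q1 else q.

(* A simulation R along which transitions into q2 may be redirected to q1
   would let the state q2 be removed. *)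
Lemma minimal_no_redirect (q1 q2 : state M) (R : state M -> state M -> Prop) :
    q1 != q2 -> R s (redirect q1 q2 s) ->
    (forall q q' a, R q q' -> R (delta q a) (redirect q1 q2 (delta q' a))) ->
    (forall q q', R q q' -> (q \in accepting M) = (q' \in accepting M)) ->
  False.
Proof.
move=> q12 Rs Rdelta Racc.
pose T := {q : state M | q != q2}.
have rP q : redirect q1 q2 q != q2 by rewrite /redirect; case: (eqVneq q q2).
pose r q : T := Sub (redirect q1 q2 q) (rP q).
pose M' : kdfa Sigma 1 := @KDFA Sigma 1 T (fun q a => r (delta (val q) a))
  (fun=> r s) [set q | val q \in accepting M].
have M'M w q (q' : state M') :
    R q (val q') -> (run q w \in accepting M) = (run q' w \in accepting M').
  elim: w q q' => [|a w IHw] q q' Rqq' /=; first by rewrite inE; apply: Racc.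
  by apply: IHw; apply: Rdelta.
have cardT : #|{: T}| < #|state M|.
  by rewrite card_sig cardC1 prednK //; apply/card_gt0P; exists q1.
case: minM => ML /(_ M') minM'; move: cardT; rewrite ltnNge minM' // => w.
by rewrite -ML !lang1 (M'M w s (r s)).
Qed.

(** No run from [s] meets an unreachable [q2], so redirecting [q2] to [s] changes nothing on
    reachable states; the simulation is equality restricted to them. *)
Lemma minimal_reachable : reachable_states M.
Proof.
move=> q2; exists ord0; apply: contrapT => no_w.
have reach w : run s w != q2 by apply/eqP => ?; apply: no_w; exists w.
have rE w : redirect s q2 (run s w) = run s w.
  by rewrite /redirect (negPf (reach w)).
apply: (@minimal_no_redirect s q2
  (fun q q' => q = q' /\ exists w, q = run s w)).
- exact: reach [::].
- by rewrite (rE [::]); split=> //; exists [::].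
- move=> q _ a [<- [w ->]].
  have runE : delta (run s w) a = run s (rcons w a) by rewrite /run foldl_rcons.
  by rewrite runE rE; split=> //; exists (rcons w a).
- by move=> q _ [<-].
Qed.

(** The Myhill-Nerode argument: equivalent states can be merged, the simulation being acceptance of
    the same words. *)
Lemma minimal_distinguishable (q1 q2 : state M) :
    (forall w, (run q1 w \in accepting M) = (run q2 w \in accepting M)) ->
  q1 = q2.
Proof.
move=> eq12; apply/eqP; apply: contrapT => /negP q12.
apply: (@minimal_no_redirect q1 q2
  (fun q q' => forall w, (run q w \in accepting M) = (run q' w \in accepting M)))
  => // [w|q q' a Rqq' w|q q' /(_ [::])//].
  by rewrite /redirect; case: eqP => // ->.
rewrite -[run _ w]/(run q (a :: w)) Rqq' /= /redirect.
by case: eqP => //= ->.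
Qed.

(** [Lhd] synchronizes to [s] because there is a single entry; a word reaching [q] from [s] then
    carries it to [q]. The loops [Ast] and [Star] occur only at the initial vertex and at [t]. *)
Lemma minimal_shift_graph_sync : synchronizing (shift_graph M).
Proof.
case=> [q|[i|[]]].
- have [i [z zq]] := minimal_reachable q; rewrite ord1 in zq.
  exists (inr Lhd :: map inl z); rewrite -cat1s.
  apply/setP=> v; rewrite end_vertices_cat inE.
  apply/existsP/eqP => [[u /andP[]]|->].
    rewrite inE => /existsP[u']; rewrite walk1.
    case: u' => [q'|[j|[]]] //; case: u => [q'|[j'|[]]] //= /eqP->.
    rewrite ord1 => uv.
    apply: (deterministic_walk (@shift_graph_det _ _ M) uv).
    by rewrite -zq; apply: shift_graph_walk_run.
  exists (inl s); rewrite -zq shift_graph_walk_run andbT inE.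
  by apply/existsP; exists (inr (inl ord0)); rewrite walk1 /=.
- exists [:: inr Ast]; apply/setP=> v; rewrite !inE.
  apply/existsP/eqP => [[u]|->]; last by exists (inr (inl i)); rewrite walk1 /=.
  rewrite walk1; case: u v => [?|[j|[]]] [?|[j'|[]]] //= _.
  by rewrite (ord1 j') (ord1 i).
- exists [:: inr Star]; apply/setP=> v; rewrite !inE.
  apply/existsP/eqP => [[u]|->]; last by exists (inr (inr tt)); rewrite walk1.
  by rewrite walk1; case: u v => [?|[?|[]]] [?|[?|[]]].
Qed.

(** A letter separates states from the two other vertices, and [Ast] separates those two. Two states
    are separated by a distinguishing word followed by [Rhd]. *)
Lemma minimal_shift_graph_reduced : 0 < #|Sigma| -> reduced (shift_graph M).
Proof.
case/card_gt0P=> c _.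
have letter (q : state M) : follower (inl q : vertex (shift_graph M)) [:: inl c].
  by rewrite shift_graph_follower_letter follower_nil.
have ast (i : 'I_1) : follower (inr (inl i) : vertex (shift_graph M)) [:: inr Ast].
  by rewrite shift_graph_follower_ast follower_nil.
have noletter_p (i : 'I_1) :
    follower (inr (inl i) : vertex (shift_graph M)) [:: inl c] = false.
  by apply/negbTE/negP => /shift_graph_follower_p[].
case=> [q|[i|[]]] [q'|[i'|[]]] uv //.
- congr inl; apply: minimal_distinguishable => w.
  have := uv (map inl w ++ [:: inr Rhd]); rewrite !shift_graph_follower_letters.
  by rewrite !shift_graph_follower_rhd follower_nil !andbT.
- by have := uv [:: inl c]; rewrite letter noletter_p.
- by have := uv [:: inl c]; rewrite letter shift_graph_follower_t.
- by have := uv [:: inl c]; rewrite letter noletter_p.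
- by rewrite (ord1 i) (ord1 i').
- by have := uv [:: inr Ast]; rewrite ast shift_graph_follower_t.
- by have := uv [:: inl c]; rewrite letter shift_graph_follower_t.
- by have := uv [:: inr Ast]; rewrite ast shift_graph_follower_t.
Qed.

End MinimalDFA.

(** The hypotheses exclude degenerate cases: unreachable states of [N] could label sequences that
    the language does not control, without entries [Ast] would occur only in the graph of [M], and
    over an empty alphabet a non-accepting state would be a dead end. *)
Theorem theorem5p4 (Sigma : finType) (k : nat) (N : kdfa Sigma k)
    (M : kdfa Sigma 1)
    (Sigma_nonempty : 0 < #|Sigma|)
    (k_gt0 : 0 < k)
    (N_reachable : reachable_states N)
    (M_minimal : minimal_dfa M (lang N)) :
  minimal_sync_det_presentation (shift_graph M) (shift_of (shift_graph N)).
Proof.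
have M_reachable := minimal_reachable M_minimal.
have HP : sync_det_presentation (shift_graph M) (shift_of (shift_graph N)).
  split; last exact: minimal_shift_graph_sync M_minimal.
    split; first exact: shift_graph_essential.
    apply/eq_factor_shift/eq_shift_graph_factor => //.
    by case: M_minimal.
  exact: shift_graph_det.
have redM := minimal_shift_graph_reduced M_minimal Sigma_nonempty.
by split=> // P' P'P; [apply: reduced_card P'P _|apply: reduced_isomorphic P'P _].
Qed.
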